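(* Let $-1<B<A\le 1$ and suppose that $$A\le\begin{cases}1-\sqrt{\frac{2}{1+e^2}}\,(1-B) & \text{if } \frac{1-AB}{1-B^2}\le\frac{1+e}{\sqrt{2(1+e^2)}},\\[2mm] e\sqrt{\frac{2}{1+e^2}}\,(1+B)-1 & \text{if } \frac{1-AB}{1-B^2}\ge\frac{1+e}{\sqrt{2(1+e^2)}}.\end{cases}$$ Then $\mathcal{S}^*[A,B]\subset\mathcal{S}^*_{\mathfrak{B}}$.
   Context: $\mathbb{D}$ is the open unit disk. $\mathcal{A}$ is the class of analytic functions $f$ in $\mathbb{D}$ with $f(z)=z+\sum_{n\ge2}a_nz^n$, and $\mathcal{S}\subset\mathcal{A}$ is the subclass of univalent functions. $f\prec g$ (subordination) means $f=g\circ w$ for some analytic $w:\mathbb{D}\to\mathbb{D}$ with $w(0)=0$. $\mathfrak{B}(z)=\sqrt{1+\tanh z}$ (principal branch), and $\mathcal{S}^*_{\mathfrak{B}}=\{f\in\mathcal{S}: zf'(z)/f(z)\prec\mathfrak{B}(z)\}$. $\mathcal{S}^*[A,B]=\{f\in\mathcal{S}: zf'(z)/f(z)\prec(1+Az)/(1+Bz)\}$. *)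

(* Defs.v *)
From Stdlib Require Import Reals Lra.
From Coquelicot Require Import Coquelicot.
Open Scope R_scope.

(* Functions on the disk are total functions C -> C; only their values on
   [disk] matter. *)
Definition disk (z : C) : Prop := Cmod z < 1.

Definition analytic_on_disk (f : C -> C) : Prop :=
  forall z : C, disk z -> @ex_derive C_AbsRing C_NormedModule f z.

Definition class_A (f : C -> C) : Prop :=
  analytic_on_disk f /\
  exists a : nat -> C,
    a 0%nat = RtoC 0 /\ a 1%nat = RtoC 1 /\
    forall z : C, disk z -> @is_pseries C_AbsRing C_NormedModule a z (f z).

Definition univalent_on_disk (f : C -> C) : Prop :=
  forall z1 z2 : C, disk z1 -> disk z2 -> f z1 = f z2 -> z1 = z2.

Definition class_S (f : C -> C) : Prop := class_A f /\ univalent_on_disk f.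

Definition subordinate (f g : C -> C) : Prop :=
  exists w : C -> C,
    analytic_on_disk w /\
    (forall z : C, disk z -> disk (w z)) /\
    w (RtoC 0) = RtoC 0 /\
    (forall z : C, disk z -> f z = g (w z)).

(* z f'(z) / f(z); at the removable singularity z = 0 it takes its limit 1,
   whereas the literal quotient would be the junk value of 0 / 0. *)
Definition starlike_quotient (f : C -> C) (z : C) : C :=
  if Ceq_dec z (RtoC 0) then RtoC 1 else (z * C_derive f z / f z)%C.

Definition Cexp (z : C) : C := (exp (Re z) * cos (Im z), exp (Re z) * sin (Im z)).

Definition Csinh (z : C) : C := ((Cexp z - Cexp (- z)) / RtoC 2)%C.
Definition Ccosh (z : C) : C := ((Cexp z + Cexp (- z)) / RtoC 2)%C.

(* The poles of tanh are the odd multiples of i * PI / 2, all outside [disk]. *)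
Definition Ctanh (z : C) : C := (Csinh z / Ccosh z)%C.

(* Principal square root in Cartesian form: the root with Re > 0, or with
   Re = 0 and Im >= 0; see [Csqrt_sqr] and [Csqrt_principal]. *)
Definition Csqrt (z : C) : C :=
  (sqrt ((Cmod z + Re z) / 2),
   if Rle_dec 0 (Im z) then sqrt ((Cmod z - Re z) / 2)
   else - sqrt ((Cmod z - Re z) / 2)).

Lemma Csqrt_sqr (z : C) : (Csqrt z * Csqrt z)%C = z.
Proof.
  pose proof (re_le_Cmod z) as Hm.
  assert (Hre : - Cmod z <= Re z <= Cmod z) by (apply Rabs_le_between; exact Hm).
  assert (Hp : 0 <= (Cmod z + Re z) / 2) by lra.
  assert (Hq : 0 <= (Cmod z - Re z) / 2) by lra.
  pose proof (sqrt_sqrt _ Hp) as Ep.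
  pose proof (sqrt_sqrt _ Hq) as Eq.
  assert (Ei : sqrt ((Cmod z + Re z) / 2) * sqrt ((Cmod z - Re z) / 2)
               = Rabs (Im z) / 2).
  { rewrite <- sqrt_mult by assumption.
    replace ((Cmod z + Re z) / 2 * ((Cmod z - Re z) / 2))
      with (Rsqr (Im z / 2)).
    - rewrite sqrt_Rsqr_abs. unfold Rdiv. rewrite Rabs_mult.
      rewrite (Rabs_right (/ 2)) by lra. reflexivity.
    - pose proof (Cmod2_alt z) as H2. unfold Rsqr. nra. }
  apply injective_projections; unfold Csqrt, Cmult; simpl;
    change (fst z) with (Re z); change (snd z) with (Im z);
    destruct (Rle_dec 0 (Im z)) as [H | H].
  - lra.
  - lra.
  - rewrite Rabs_right in Ei by lra. lra.
  - rewrite Rabs_left in Ei by lra. lra.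
Qed.

Lemma Csqrt_principal (z : C) :
  0 < Re (Csqrt z) \/ (Re (Csqrt z) = 0 /\ 0 <= Im (Csqrt z)).
Proof.
  pose proof (sqrt_pos ((Cmod z + Re z) / 2)) as [H | H].
  - left. exact H.
  - right. split; [symmetry; exact H |].
    unfold Csqrt; simpl.
    destruct (Rle_dec 0 (Im z)) as [Hi | Hi]; [apply sqrt_pos |].
    exfalso.
    pose proof (f_equal (@snd R R) (Csqrt_sqr z)) as E.
    unfold Csqrt, Cmult in E; simpl in E.
    rewrite <- H in E. change (snd z) with (Im z) in E. lra.
Qed.

Definition frak_B (z : C) : C := Csqrt (RtoC 1 + Ctanh z)%C.

Definition S_star_frak_B (f : C -> C) : Prop :=
  class_S f /\ subordinate (starlike_quotient f) frak_B.

Definition janowski (A B : R) (z : C) : C :=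
  ((RtoC 1 + RtoC A * z) / (RtoC 1 + RtoC B * z))%C.

Definition S_star_janowski (A B : R) (f : C -> C) : Prop :=
  class_S f /\ subordinate (starlike_quotient f) (janowski A B).

(* Main.v *)
(** Put m = sqrt (2 / (1 + e^2)), so that [-1] and [1] are mapped by [frak_B] to
    m and e m.  The Janowski image of the disk is the disk with diameter
    [(1-A)/(1-B), (1+A)/(1+B)], and the hypotheses say that this diameter lies in
    [m, e m].  It thus suffices that the inverse
    zeta(u) = (1/2) log (u^2 / (2 - u^2)) of [frak_B] maps the disk with diameter
    [m, e m] into the unit disk: then [frak_B_inv], the Janowski map and the given
    Schwarz function compose to the required Schwarz function.

    Write 2 zeta = X + i Y and s = e / (1 + e^2) = 1 / (2 cosh 1).  In terms of
    P = exp X and T = |1 + exp (2 zeta)|, membership of u in the disk reads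
    (1 - 2s)(P - T) + 2 s^2 (P + 1/P) - (1 + 2s - 4s^2) cos Y < 0.  As
    T <= P + 1, this gives
    (1 + 2s - 4s^2)(1 - cos Y) < 4 s^2 (cosh 2 - cosh X), which is incompatible
    with X^2 + Y^2 >= 4. *)
Require Import Defs.
From Stdlib Require Import Reals Lra Psatz.
From Coquelicot Require Import Coquelicot.
Open Scope R_scope.

(** * Real inequalities for the hyperbolic functions and the cosine *)

(** The derivative of [t * cosh t - sinh t] is [t * sinh t], positive for t > 0. *)
Lemma sinh_le_mul_cosh (x : R) (hx : 0 <= x) : sinh x <= x * cosh x.
Proof.
  destruct hx as [hx | <-]; [| rewrite sinh_0; lra].
  destruct (MVT_cor2 (fun t => t * cosh t - sinh t) (fun t => t * sinh t) 0 x hx)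
    as [c [E [hc _]]].
  - intros c _. apply is_derive_Reals. unfold cosh, sinh. auto_derive; [auto |]. field.
  - rewrite sinh_0 in E.
    assert (hs : 0 < sinh c) by (rewrite <- sinh_0; apply sinh_lt; exact hc).
    pose proof (Rmult_lt_0_compat _ _ (Rmult_lt_0_compat _ _ hc hs) hx).
    lra.
Qed.

Lemma sinh_plus (x y : R) : sinh (x + y) = sinh x * cosh y + cosh x * sinh y.
Proof.
  unfold sinh, cosh. rewrite Ropp_plus_distr, !exp_plus. field.
Qed.

Lemma cosh_plus_minus (x y : R) :
  cosh (x + y) - cosh (x - y) = 2 * (sinh x * sinh y).
Proof.
  unfold sinh, cosh. rewrite Ropp_plus_distr, Ropp_minus_distr.
  unfold Rminus. rewrite !exp_plus. field.
Qed.

Lemma sinh_nonneg (x : R) (hx : 0 <= x) : 0 <= sinh x.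
Proof.
  destruct hx as [hx | <-]; [| rewrite sinh_0; lra].
  left. rewrite <- sinh_0. apply sinh_lt. exact hx.
Qed.

Lemma cosh_even (x : R) : cosh (- x) = cosh x.
Proof. unfold cosh. rewrite Ropp_involutive. field. Qed.

Lemma cosh_le_cosh (x y : R) (hx : 0 <= x) (hxy : x <= y) : cosh x <= cosh y.
Proof.
  pose proof (cosh_plus_minus ((y + x) / 2) ((y - x) / 2)) as E.
  replace ((y + x) / 2 + (y - x) / 2) with y in E by field.
  replace ((y + x) / 2 - (y - x) / 2) with x in E by field.
  assert (0 <= sinh ((y + x) / 2)) by (apply sinh_nonneg; lra).
  assert (0 <= sinh ((y - x) / 2)) by (apply sinh_nonneg; lra).
  nra.
Qed.

(* The tangent line at [x^2 = 4] to [cosh x], a convex function of [x^2]. *)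
Lemma cosh_two_minus_le (x : R) (hx : -2 <= x <= 2) :
  cosh 2 - cosh x <= (4 - x ^ 2) * (sinh 2 / 4).
Proof.
  (* With p + q = 2 and p - q = x the claim becomes 2 sinh p sinh q <= p q sinh (p + q). It is the
     sum of sinh q <= q cosh q times p sinh p and sinh p <= p cosh p times q sinh q. *)
  set (p := (2 + x) / 2). set (q := (2 - x) / 2).
  replace (cosh 2) with (cosh (p + q)) by (f_equal; unfold p, q; field).
  replace (cosh x) with (cosh (p - q)) by (f_equal; unfold p, q; field).
  replace (sinh 2) with (sinh (p + q)) by (f_equal; unfold p, q; field).
  rewrite cosh_plus_minus, sinh_plus.
  assert (hp : 0 <= p) by (unfold p; lra).
  assert (hq : 0 <= q) by (unfold q; lra).
  pose proof (sinh_le_mul_cosh p hp). pose proof (sinh_le_mul_cosh q hq).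
  pose proof (sinh_nonneg p hp). pose proof (sinh_nonneg q hq).
  replace (4 - x ^ 2) with (4 * (p * q)) by (unfold p, q; field).
  assert (p + q = 2) by (unfold p, q; field).
  assert (p * (sinh p * sinh q) <= p * (sinh p * (q * cosh q))).
  { apply Rmult_le_compat_l; [exact hp |]. apply Rmult_le_compat_l; assumption. }
  assert (q * (sinh q * sinh p) <= q * (sinh q * (p * cosh p))).
  { apply Rmult_le_compat_l; [exact hq |]. apply Rmult_le_compat_l; assumption. }
  nra.
Qed.

(** For |y| <= 2 the Taylor bound gives 1 - cos y >= y^2/3 + y^2 (4 - y^2)/24. Beyond 2, the cosine
    decreases up to PI, so the value 4/3 reached at 2 persists. It is applied with t = 4 - X^2. *)
Lemma one_minus_cos_ge (t y : R) (ht : t <= 4) (hty : t <= y ^ 2)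
  (hy : -PI <= y <= PI) : t / 3 <= 1 - cos y.
Proof.
  assert (h2 : forall x, 0 <= x <= 2 -> x ^ 2 / 3 <= 1 - cos x).
  { intros x hx.
    pose proof (pre_cos_bound x 0 ltac:(lra) ltac:(lra)) as [_ H].
    replace (cos_approx x (2 * (0 + 1))) with (1 - x ^ 2 / 2 + x ^ 4 / 24) in H
      by (unfold cos_approx, cos_term; simpl; field).
    assert (0 <= x ^ 2 * (4 - x ^ 2)) by (apply Rmult_le_pos; nra).
    nra. }
  assert (E : cos (Rabs y) = cos y).
  { unfold Rabs. destruct (Rcase_abs y); [apply cos_neg | reflexivity]. }
  rewrite <- E.
  assert (hsq : y ^ 2 = Rabs y ^ 2) by (rewrite <- Rsqr_pow2, <- Rsqr_pow2; apply Rsqr_abs).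
  assert (hab : Rabs y <= PI) by (apply Rabs_le; lra).
  pose proof (Rabs_pos y).
  destruct (Rle_dec (Rabs y) 2) as [h | h].
  - pose proof (h2 (Rabs y) ltac:(lra)). lra.
  - pose proof (h2 2 ltac:(lra)).
    assert (cos (Rabs y) < cos 2).
    { apply cos_decreasing_1; pose proof PI2_3_2; unfold PI2 in *; lra. }
    lra.
Qed.

(** * The disk in logarithmic coordinates *)

Lemma exp_1_bounds : 2 < exp 1 <= 3.
Proof.
  split; [| exact exp_le_3].
  pose proof (exp_ineq1 1 ltac:(lra)). lra.
Qed.

Lemma cosh_2_exp_1 : cosh 2 = (exp 1 ^ 2 + / exp 1 ^ 2) / 2.
Proof.
  unfold cosh. replace 2 with (1 + 1) at 1 2 by ring.
  rewrite exp_Ropp, exp_plus. f_equal. simpl. rewrite Rmult_1_r. reflexivity.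
Qed.

Lemma sinh_2_exp_1 : sinh 2 = (exp 1 ^ 2 - / exp 1 ^ 2) / 2.
Proof.
  unfold sinh. replace 2 with (1 + 1) at 1 2 by ring.
  rewrite exp_Ropp, exp_plus. f_equal. simpl. rewrite Rmult_1_r. reflexivity.
Qed.

(** Suppose X^2 + Y^2 >= 4. If |X| >= 2, then cosh X >= cosh 2 contradicts [H1]. If |X| < 2, the
    tangent line bounds the right side of [H1] by (4 - X^2) s^2 sinh 2, while 1 - cos Y >= (4 -
    X^2)/3; the contradiction then rests on the comparison of coefficients [hcs]. *)
Lemma log_disk_bound (X Y T s : R)
  (hs : s = exp 1 / (1 + exp 1 ^ 2))
  (hY : -PI <= Y <= PI)
  (hT : T <= exp X + 1)
  (H : (1 - 2 * s) * (exp X - T) + 2 * s ^ 2 * (exp X + / exp X)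
         - (1 + 2 * s - 4 * s ^ 2) * cos Y < 0) :
  X ^ 2 + Y ^ 2 < 4.
Proof.
  destruct (Rlt_dec (X ^ 2 + Y ^ 2) 4) as [h | h]; [exact h | exfalso].
  pose proof exp_1_bounds as He.
  pose proof cosh_2_exp_1 as Hc2. pose proof sinh_2_exp_1 as Hs2.
  set (e := exp 1) in *.
  assert (hd : 0 < 1 + e ^ 2) by nra.
  assert (hs1 : 0 <= 1 - 2 * s).
  { rewrite hs. replace (1 - 2 * (e / (1 + e ^ 2))) with ((e - 1) ^ 2 / (1 + e ^ 2)) by (field; lra).
    apply Rdiv_le_0_compat; [apply pow2_ge_0 | lra]. }
  assert (hs0 : 0 < s) by (rewrite hs; apply Rdiv_lt_0_compat; lra).
  assert (hg : 0 < 1 + 2 * s - 4 * s ^ 2) by nra.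
  assert (E2 : 4 * s ^ 2 * cosh 2 = 2 - 4 * s ^ 2).
  { rewrite Hc2, hs. field. split; lra. }
  assert (hcs : s ^ 2 * sinh 2 <= (1 + 2 * s - 4 * s ^ 2) / 3).
  { apply Rminus_le.
    replace (s ^ 2 * sinh 2 - (1 + 2 * s - 4 * s ^ 2) / 3)
      with (- ((e ^ 3 * (3 - e) + 5 + e * (e - 2) ^ 2) / (6 * (1 + e ^ 2) ^ 2)))
      by (rewrite Hs2, hs; field; split; lra).
    apply Ropp_le_cancel. rewrite Ropp_0, Ropp_involutive.
    apply Rdiv_le_0_compat.
    - pose proof (pow_lt e 3 ltac:(lra)). pose proof (pow2_ge_0 (e - 2)). nra.
    - apply Rmult_lt_0_compat; [lra | apply pow_lt; lra]. }
  assert (hX : exp X + / exp X = 2 * cosh X).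
  { unfold cosh. rewrite exp_Ropp. field. apply Rgt_not_eq, exp_pos. }
  (* Since 1 - 2s >= 0, T may be replaced by exp X + 1. The constants add up to (1 - 2s) + (1 + 2s -
     4s^2) = 2 - 4s^2, which is 4 s^2 cosh 2 because s = 1 / (2 cosh 1). *)
  assert (H1 : (1 + 2 * s - 4 * s ^ 2) * (1 - cos Y) < 4 * s ^ 2 * (cosh 2 - cosh X)) by nra.
  pose proof (COS_bound Y).
  destruct (Rle_dec 2 (Rabs X)) as [h2 | h2].
  - assert (cosh 2 <= cosh X).
    { replace (cosh X) with (cosh (Rabs X)).
      - apply cosh_le_cosh; lra.
      - unfold Rabs. destruct (Rcase_abs X); [apply cosh_even | reflexivity]. }
    nra.
  - assert (hX2 : -2 <= X <= 2) by (apply Rabs_le_between; lra).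
    pose proof (cosh_two_minus_le X hX2) as h3.
    pose proof (one_minus_cos_ge (4 - X ^ 2) Y ltac:(nra) ltac:(lra) hY) as h4.
    assert (0 <= 4 - X ^ 2) by nra.
    assert (4 * s ^ 2 * (cosh 2 - cosh X) <= (4 - X ^ 2) * (s ^ 2 * sinh 2)).
    { pose proof (Rmult_le_compat_l (4 * s ^ 2) _ _ ltac:(nra) h3). lra. }
    assert ((4 - X ^ 2) * (s ^ 2 * sinh 2) <= (4 - X ^ 2) * ((1 + 2 * s - 4 * s ^ 2) / 3))
      by (apply Rmult_le_compat_l; assumption).
    assert ((1 + 2 * s - 4 * s ^ 2) * ((4 - X ^ 2) / 3) <= (1 + 2 * s - 4 * s ^ 2) * (1 - cos Y))
      by (apply Rmult_le_compat_l; lra).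
    lra.
Qed.

(** * Complex exponential, logarithm and square root *)

(** The principal logarithm on the right half-plane, where the arctangent of the slope is the
    argument; it is meant for [0 < Re z]. *)
Definition Clog (z : C) : C := (ln (Re z ^ 2 + Im z ^ 2) / 2, atan (Im z / Re z)).

Lemma Cexp_plus (z w : C) : Cexp (z + w) = (Cexp z * Cexp w)%C.
Proof.
  destruct z as [a b], w as [c d]. unfold Cexp, Cplus, Cmult; simpl.
  rewrite exp_plus, cos_plus, sin_plus. f_equal; ring.
Qed.

Lemma Cexp_0 : Cexp 0 = 1.
Proof.
  unfold Cexp; simpl. rewrite exp_0, cos_0, sin_0.
  apply injective_projections; simpl; ring.
Qed.

Lemma Cexp_opp (z : C) : (Cexp z * Cexp (- z))%C = 1.
Proof.
  rewrite <- Cexp_plus, <- Cexp_0. f_equal. ring.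
Qed.

Lemma Cexp_Clog (z : C) (hz : 0 < Re z) : Cexp (Clog z) = z.
Proof.
  destruct z as [x y]. simpl in hz. unfold Cexp, Clog. cbn [Re Im fst snd].
  assert (hn : 0 < x ^ 2 + y ^ 2) by nra.
  rewrite cos_atan, sin_atan.
  assert (Hs : sqrt (1 + Rsqr (y / x)) = sqrt (x ^ 2 + y ^ 2) / x).
  { replace (1 + Rsqr (y / x)) with ((x ^ 2 + y ^ 2) / x ^ 2) by (unfold Rsqr; field; lra).
    rewrite sqrt_div by nra. rewrite sqrt_pow2 by lra. reflexivity. }
  assert (He : exp (ln (x ^ 2 + y ^ 2) / 2) = sqrt (x ^ 2 + y ^ 2)).
  { rewrite <- (Rpower_sqrt _ hn). unfold Rpower. f_equal. field. }
  rewrite Hs, He. pose proof (sqrt_lt_R0 _ hn).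
  f_equal; field; lra.
Qed.

Lemma Clog_1 : Clog 1 = 0.
Proof.
  unfold Clog, RtoC; simpl.
  replace (1 * (1 * 1) + 0 * (0 * 1)) with 1 by ring.
  rewrite ln_1. replace (0 / 1) with 0 by field. rewrite atan_0. f_equal. field.
Qed.

(** The root c satisfies (c - u)(c + u) = 0, and c = -u would have negative real part, which
    [Csqrt_principal] excludes. *)
Lemma Csqrt_sqr_of_Re_pos (u : C) (hu : 0 < Re u) : Csqrt (u * u) = u.
Proof.
  pose proof (Csqrt_sqr (u * u)) as E. pose proof (Csqrt_principal (u * u)) as Hp.
  generalize dependent (Csqrt (u * u)). intros c E Hp.
  assert (E0 : ((c - u) * (c + u))%C = 0).
  { replace ((c - u) * (c + u))%C with (c * c - u * u)%C by ring. rewrite E. ring. }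
  destruct (Ceq_dec (c - u) 0) as [h | h].
  - replace c with (c - u + u)%C by ring. rewrite h. ring.
  - exfalso.
    assert (E1 : (c + u)%C = 0).
    { replace (c + u)%C with (/ (c - u) * ((c - u) * (c + u)))%C by (field; exact h).
      rewrite E0. ring. }
    apply (f_equal Re) in E1. unfold Cplus in E1. simpl in E1.
    change (fst c) with (Re c) in E1. change (fst u) with (Re u) in E1.
    destruct Hp as [Hp | [Hp _]]; lra.
Qed.

(** * Complex differentiability *)

(** The common criterion for affine maps, the inverse and the logarithm: within [eps / (Rabs K + 1)]
    of z the quadratic error is at most eps |h|. *)
Lemma is_C_derive_of_quadratic_error (f : C -> C) (z l : C) (K d : R) (hd : 0 < d)
  (H : forall h : C, Cmod h < d ->
         Cmod (f (z + h)%C - f z - h * l) <= K * Cmod h ^ 2) :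
  @is_derive C_AbsRing C_NormedModule f z l.
Proof.
  split; [apply (is_linear_scal_l (K := C_AbsRing) (V := C_NormedModule))|].
  intros x Hx.
  assert (Ex : z = x) by (exact (is_filter_lim_locally_unique (K:=C_AbsRing) (V := AbsRing_NormedModule C_AbsRing) z x Hx)).
  subst x. intros eps.
  pose proof (Rabs_pos K).
  assert (hd' : 0 < Rmin d (eps / (Rabs K + 1))).
  { apply Rmin_pos; [exact hd |]. apply Rdiv_lt_0_compat; [apply cond_pos | lra]. }
  exists (mkposreal _ hd'). intros y Hy.
  change (Cmod (y - z)%C < Rmin d (eps / (Rabs K + 1))) in Hy.
  change (Cmod (f y - f z - (y - z) * l)%C <= eps * Cmod (y - z)%C).
  assert (Ey : forall w : C, (z + (w - z))%C = w) by (intros w; ring).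
  specialize (H (y - z)%C). rewrite Ey in H.
  pose proof (Rmin_l d (eps / (Rabs K + 1))). pose proof (Rmin_r d (eps / (Rabs K + 1))).
  specialize (H ltac:(lra)).
  eapply Rle_trans; [exact H |].
  set (m := Cmod (y - z)) in *.
  assert (0 <= m) by apply Cmod_ge_0.
  replace (K * m ^ 2) with (K * m * m) by ring.
  apply Rmult_le_compat_r; [assumption |].
  assert (hm : m * (Rabs K + 1) <= eps).
  { apply Rmult_le_reg_r with (/ (Rabs K + 1)); [apply Rinv_0_lt_compat; lra |].
    rewrite Rmult_assoc, Rinv_r by lra. unfold Rdiv in *. lra. }
  pose proof (Rle_abs K). nra.
Qed.

(** The two module structures on C have convertible error estimates, so only linearity is proved
    again. The general chain and product rules ask for the second structure. *)
Lemma ex_C_derive_AbsRing (f : C -> C) (z : C)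
  (H : @ex_derive C_AbsRing C_NormedModule f z) :
  @ex_derive C_AbsRing (AbsRing_NormedModule C_AbsRing) f z.
Proof.
  destruct H as [l [Hl H]]. exists l. split.
  - apply (is_linear_scal_l (K := C_AbsRing) (V := AbsRing_NormedModule C_AbsRing)).
  - exact H.
Qed.

Lemma ex_C_derive_comp (f g : C -> C) (z : C)
  (Hf : @ex_derive C_AbsRing C_NormedModule f (g z))
  (Hg : @ex_derive C_AbsRing C_NormedModule g z) :
  @ex_derive C_AbsRing C_NormedModule (fun x => f (g x)) z.
Proof.
  apply (ex_derive_comp (K := C_AbsRing) (V := C_NormedModule)); [exact Hf |].
  apply ex_C_derive_AbsRing. exact Hg.
Qed.

Lemma ex_C_derive_affine (p q z : C) :
  @ex_derive C_AbsRing C_NormedModule (fun x => p + q * x)%C z.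
Proof.
  exists q. apply (is_C_derive_of_quadratic_error _ _ _ 0 1); [lra |].
  intros h _. replace (_ - _)%C with (RtoC 0) by ring. rewrite Cmod_0. lra.
Qed.

Lemma Cmod_add_ge_half (z h : C) (hh : Cmod h < Cmod z / 2) :
  Cmod z / 2 <= Cmod (z + h).
Proof.
  pose proof (Cmod_triangle (z + h) (- h)) as H.
  replace (z + h + - h)%C with z in H by ring.
  rewrite Cmod_opp in H. lra.
Qed.

(** The difference is -h k / (z (z + k)), and |z + k| >= |z|/2. The separate k serves both k = h for
    the inverse and k = t h for the logarithm. *)
Lemma Cmod_div_sub_div_le (z h k : C) (hz : z <> 0) (hk : Cmod k <= Cmod h)
  (hh : Cmod h < Cmod z / 2) :
  Cmod (h / (z + k) - h / z) <= 2 / Cmod z ^ 2 * Cmod h ^ 2.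
Proof.
  pose proof (proj1 (Cmod_gt_0 z) hz) as hz'.
  pose proof (Cmod_add_ge_half z k ltac:(lra)) as hzk.
  assert (hzk' : (z + k)%C <> 0) by (apply Cmod_gt_0; lra).
  replace (h / (z + k) - h / z)%C with (- (h * k / (z * (z + k))))%C
    by (field; split; assumption).
  rewrite Cmod_opp, Cmod_div, !Cmod_mult by (apply Cmult_neq_0; assumption).
  pose proof (Cmod_ge_0 h). pose proof (Cmod_ge_0 k).
  set (m := Cmod z) in *. set (n := Cmod (z + k)) in *.
  replace (2 / m ^ 2 * Cmod h ^ 2) with (Cmod h * Cmod h * / (m * (m / 2))) by (field; lra).
  unfold Rdiv at 1. apply Rmult_le_compat.
  - nra.
  - left. apply Rinv_0_lt_compat. nra.
  - nra.
  - apply Rinv_le_contravar; nra.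
Qed.

Lemma is_C_derive_inv (z : C) (hz : z <> 0) :
  @is_derive C_AbsRing C_NormedModule Cinv z (- (/ (z * z)))%C.
Proof.
  pose proof (proj1 (Cmod_gt_0 z) hz) as hz'.
  apply (is_C_derive_of_quadratic_error _ _ _ (2 / Cmod z ^ 3) (Cmod z / 2)); [lra |].
  intros h hh.
  pose proof (Cmod_add_ge_half z h hh) as hzh.
  assert (hzh' : (z + h)%C <> 0) by (apply Cmod_gt_0; lra).
  pose proof (Cmod_div_sub_div_le z h h hz (Rle_refl _) hh) as H.
  replace (/ (z + h) - / z - h * - / (z * z))%C
    with (- (/ z * (h / (z + h) - h / z)))%C by (field; split; assumption).
  rewrite Cmod_opp, Cmod_mult, Cmod_inv by exact hz.
  replace (2 / Cmod z ^ 3 * Cmod h ^ 2) with (/ Cmod z * (2 / Cmod z ^ 2 * Cmod h ^ 2))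
    by (field; lra).
  apply Rmult_le_compat_l; [left; apply Rinv_0_lt_compat; exact hz' | exact H].
Qed.

Lemma Cmod_le_abs_sum (z : C) : Cmod z <= Rabs (Re z) + Rabs (Im z).
Proof.
  pose proof (Cmod2_alt z) as H. pose proof (Cmod_ge_0 z).
  pose proof (Rabs_pos (Re z)). pose proof (Rabs_pos (Im z)).
  pose proof (pow2_abs (Re z)). pose proof (pow2_abs (Im z)).
  nra.
Qed.

Lemma Rabs_Im_le_Cmod (z : C) : Rabs (Im z) <= Cmod z.
Proof.
  eapply Rle_trans; [apply Rmax_r | apply (Rmax_Cmod z)].
Qed.

(* Along the segment [z + t h], the derivative of the logarithm in [t] is
   [h / (z + t h)], so the mean value theorem applies to both components. *)
Lemma is_C_derive_log (z : C) (hz : 0 < Re z) :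
  @is_derive C_AbsRing C_NormedModule Clog z (/ z)%C.
Proof.
  assert (hz0 : z <> 0) by (intros ->; simpl in hz; lra).
  pose proof (re_le_Cmod z) as hzm. rewrite Rabs_right in hzm by lra.
  (* The radius [Re z / 2] keeps the segment in the right half-plane. The mean value points of the
     two components may differ, so each component is bounded separately and 4 = 2 + 2. *)
  apply (is_C_derive_of_quadratic_error _ _ _ (4 / Cmod z ^ 2) (Re z / 2)); [lra |].
  intros h hh.
  assert (hpos : forall t, 0 <= t <= 1 -> 0 < Re z + t * Re h).
  { intros t ht. pose proof (re_le_Cmod h) as hr. apply Rabs_le_between in hr. nra. }
  assert (herr : forall t, 0 < t < 1 ->
      Cmod (h / (z + RtoC t * h) - h / z) <= 2 / Cmod z ^ 2 * Cmod h ^ 2).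
  { intros t ht. apply Cmod_div_sub_div_le; [exact hz0 | | lra].
    rewrite Cmod_mult, Cmod_R, Rabs_right by lra. pose proof (Cmod_ge_0 h). nra. }
  destruct (MVT_cor2 (fun t => Re (Clog (z + RtoC t * h)))
              (fun t => Re (h / (z + RtoC t * h))%C) 0 1 Rlt_0_1) as [t1 [E1 ht1]].
  { intros t ht. specialize (hpos t ht). apply is_derive_Reals.
    destruct z as [x y], h as [p q]. simpl in *.
    assert (0 < x + t * p) by lra.
    apply is_derive_ext with (fun t => ln ((x + t * p) ^ 2 + (y + t * q) ^ 2) / 2).
    - intros s. do 2 f_equal. ring.
    - assert (0 < (x + t * p) ^ 2 + (y + t * q) ^ 2)
        by (pose proof (pow2_ge_0 (y + t * q)); nra).
      auto_derive; [lra |]. field. lra. }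
  destruct (MVT_cor2 (fun t => Im (Clog (z + RtoC t * h)))
              (fun t => Im (h / (z + RtoC t * h))%C) 0 1 Rlt_0_1) as [t2 [E2 ht2]].
  { intros t ht. specialize (hpos t ht). apply is_derive_Reals.
    destruct z as [x y], h as [p q]. simpl in *.
    assert (0 < x + t * p) by lra.
    apply is_derive_ext with (fun t => atan ((y + t * q) / (x + t * p))).
    - intros s. do 2 f_equal; ring.
    - assert (0 < (x + t * p) ^ 2 + (y + t * q) ^ 2)
        by (pose proof (pow2_ge_0 (y + t * q)); nra).
      auto_derive; [lra |]. unfold Rsqr. field. repeat split; lra. }
  pose proof (herr t1 ht1) as H1. pose proof (herr t2 ht2) as H2.
  replace (z + RtoC 1 * h)%C with (z + h)%C in E1, E2 by ring.
  replace (z + RtoC 0 * h)%C with z in E1, E2 by ring.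
  eapply Rle_trans; [apply Cmod_le_abs_sum |].
  replace (4 / Cmod z ^ 2 * Cmod h ^ 2)
    with (2 / Cmod z ^ 2 * Cmod h ^ 2 + 2 / Cmod z ^ 2 * Cmod h ^ 2) by (field; lra).
  apply Rplus_le_compat.
  - eapply Rle_trans; [| exact H1].
    eapply Rle_trans; [| apply re_le_Cmod]. right. f_equal.
    change (Re (Clog (z + h)) - Re (Clog z) - Re (h / z)%C
            = Re (h / (z + RtoC t1 * h))%C - Re (h / z)%C).
    lra.
  - eapply Rle_trans; [| exact H2].
    eapply Rle_trans; [| apply Rabs_Im_le_Cmod]. right. f_equal.
    change (Im (Clog (z + h)) - Im (Clog z) - Im (h / z)%C
            = Im (h / (z + RtoC t2 * h))%C - Im (h / z)%C).
    lra.
Qed.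

(** * The inverse of the square-root-tanh map *)

(* [log (u^2 / (2 - u^2)) / 2], split so that for [0 < Re u < sqrt 2] every
   logarithm is taken in the right half-plane, where [Clog] is analytic. *)
Definition frak_B_inv (u : C) : C :=
  (Clog u + (0 + RtoC (- / 2) * (Clog (RtoC (sqrt 2) + RtoC (-1) * u)
                                 + Clog (RtoC (sqrt 2) + 1 * u))))%C.

Lemma RtoC_m1 : RtoC (-1) = (- (1))%C.
Proof. apply injective_projections; simpl; ring. Qed.

Lemma sqrt_2_sq : sqrt 2 * sqrt 2 = 2.
Proof. apply sqrt_sqrt. lra. Qed.

Lemma ex_C_derive_frak_B_inv (u : C) (hu : 0 < Re u < sqrt 2) :
  @ex_derive C_AbsRing C_NormedModule frak_B_inv u.
Proof.
  assert (hlog : forall v, 0 < Re v -> @ex_derive C_AbsRing C_NormedModule Clog v)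
    by (intros v hv; exists (/ v)%C; apply is_C_derive_log; exact hv).
  assert (haff : forall p q : C, 0 < Re (p + q * u)%C ->
      @ex_derive C_AbsRing C_NormedModule (fun v => Clog (p + q * v))%C u).
  { intros p q hpq. apply (ex_C_derive_comp Clog (fun v => p + q * v)%C).
    - apply hlog. exact hpq.
    - apply ex_C_derive_affine. }
  apply (ex_derive_plus (K := C_AbsRing) (V := C_NormedModule)); [apply hlog; lra |].
  apply (ex_C_derive_comp (fun s => 0 + RtoC (- / 2) * s)%C
           (fun v => Clog (RtoC (sqrt 2) + RtoC (-1) * v) + Clog (RtoC (sqrt 2) + 1 * v))%C);
    [apply ex_C_derive_affine |].
  apply (ex_derive_plus (K := C_AbsRing) (V := C_NormedModule)); apply haff;
    destruct u; simpl in *; lra.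
Qed.

(** Doubling turns the coefficient -1/2 into -1, and 2 - u^2 = (sqrt 2 - u)(sqrt 2 + u) cancels the
    two logarithms. *)
Lemma Cexp_double_frak_B_inv (u : C) (hu : 0 < Re u < sqrt 2) :
  (Cexp (frak_B_inv u + frak_B_inv u) * (2 - u * u))%C = (u * u)%C.
Proof.
  unfold frak_B_inv.
  set (v := (RtoC (sqrt 2) + RtoC (-1) * u)%C). set (w := (RtoC (sqrt 2) + 1 * u)%C).
  assert (hv : 0 < Re v) by (destruct u; simpl in *; lra).
  assert (hw : 0 < Re w) by (destruct u; simpl in *; lra).
  assert (E2 : (RtoC (sqrt 2) * RtoC (sqrt 2))%C = 2)
    by (rewrite <- RtoC_mult, sqrt_2_sq; reflexivity).
  assert (E : (2 - u * u)%C = (v * w)%C).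
  { unfold v, w. rewrite <- E2, RtoC_m1. ring. }
  assert (Eh : (RtoC (- / 2) + RtoC (- / 2))%C = RtoC (-1)).
  { rewrite <- RtoC_plus. f_equal. field. }
  replace (_ + _ + _)%C with (Clog u + (Clog u + ((- (Clog v)) + - Clog w)))%C.
  - rewrite E, !Cexp_plus, Cexp_Clog by lra.
    pose proof (Cexp_opp (Clog v)) as Ev. pose proof (Cexp_opp (Clog w)) as Ew.
    rewrite Cexp_Clog in Ev, Ew by assumption.
    transitivity (u * u * (v * Cexp (- Clog v)) * (w * Cexp (- Clog w)))%C; [ring |].
    rewrite Ev, Ew. ring.
  - transitivity (Clog u + Clog u + (RtoC (- / 2) + RtoC (- / 2)) * (Clog v + Clog w))%C; [| ring].
    rewrite Eh, RtoC_m1. ring.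
Qed.

Lemma Re_lt_sqrt_2_neq (u : C) (hu : 0 < Re u < sqrt 2) : (2 - u * u)%C <> 0.
Proof.
  intros E. pose proof sqrt_2_sq.
  destruct u as [a b]. unfold Cminus, Cplus, Copp, Cmult, RtoC in E. simpl in *.
  injection E. intros.
  assert (b = 0) by nra. subst b. nra.
Qed.

(** With x = exp zeta and y = 1/x, 1 + tanh zeta = 2x / (x + y) = 2x^2 / (x^2 + 1), which equals u^2
    because x^2 (2 - u^2) = u^2. *)
Lemma frak_B_frak_B_inv (u : C) (hu : 0 < Re u < sqrt 2) : frak_B (frak_B_inv u) = u.
Proof.
  unfold frak_B.
  rewrite <- (Csqrt_sqr_of_Re_pos u) at 2 by lra. f_equal.
  pose proof (Cexp_double_frak_B_inv u hu) as E. rewrite Cexp_plus in E.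
  pose proof (Re_lt_sqrt_2_neq u hu) as hn.
  pose proof (Cexp_opp (frak_B_inv u)) as E1.
  unfold Ctanh, Csinh, Ccosh.
  set (x := Cexp (frak_B_inv u)) in *. set (y := Cexp (- frak_B_inv u)) in *.
  assert (hx : x <> 0).
  { intros h. rewrite h in E1. rewrite Cmult_0_l in E1. injection E1. lra. }
  (* cosh zeta does not vanish: x (x + y)(2 - u^2) = u^2 + (2 - u^2) = 2. *)
  assert (hxy : (x + y)%C <> 0).
  { intros h.
    assert (E2 : (x * (x + y) * (2 - u * u))%C = 2).
    { transitivity (x * x * (2 - u * u) + (x * y) * (2 - u * u))%C; [ring |].
      rewrite E, E1. ring. }
    rewrite h in E2. rewrite Cmult_0_r, Cmult_0_l in E2. injection E2. lra. }
  assert (h2 : RtoC 2 <> 0) by (intros h; injection h; lra).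
  assert (E3 : (u * u * (x + y) * x)%C = (2 * x * x)%C).
  { transitivity (u * u * (x * x) + u * u * (x * y))%C; [ring |].
    rewrite E1. transitivity (u * u * (x * x) + x * x * (2 - u * u))%C; [rewrite E|]; ring. }
  transitivity (2 * x * x / ((x + y) * x))%C.
  - field. repeat split; assumption.
  - rewrite <- E3. field. repeat split; assumption.
Qed.

Lemma frak_B_inv_1 : frak_B_inv 1 = 0.
Proof.
  unfold frak_B_inv. rewrite Clog_1.
  replace (_ + RtoC (-1) * 1)%C with (RtoC (sqrt 2 - 1))
    by (rewrite RtoC_minus, RtoC_m1; ring).
  replace (_ + 1 * 1)%C with (RtoC (sqrt 2 + 1)) by (rewrite RtoC_plus; ring).
  pose proof sqrt_2_sq. pose proof (sqrt_pos 2).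
  assert (h1 : 1 < sqrt 2) by nra.
  replace (Clog (RtoC (sqrt 2 - 1)) + Clog (RtoC (sqrt 2 + 1)))%C with (RtoC 0); [ring |].
  unfold Clog, Cplus, RtoC. simpl.
  replace (0 / (sqrt 2 - 1)) with 0 by (field; lra).
  replace (0 / (sqrt 2 + 1)) with 0 by (field; lra).
  rewrite atan_0. f_equal; [| ring].
  transitivity (ln (((sqrt 2 - 1) ^ 2) * (sqrt 2 + 1) ^ 2) / 2).
  - replace ((sqrt 2 - 1) ^ 2 * (sqrt 2 + 1) ^ 2) with ((sqrt 2 * sqrt 2 - 1) ^ 2) by ring.
    rewrite sqrt_2_sq. replace ((2 - 1) ^ 2) with 1 by ring. rewrite ln_1. field.
  - rewrite ln_mult by nra. rewrite Rdiv_plus_distr. f_equal; do 2 f_equal; ring.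
Qed.

(** This puts Y in the range required by [log_disk_bound]. As |arg u| <= PI/4, the term 2 arg u
    contributes at most PI/2; the arguments of sqrt 2 - u and sqrt 2 + u have opposite signs, so
    their sum contributes at most PI/2 more. *)
Lemma Im_frak_B_inv_bound (u : C) (hu : 0 < Re u < sqrt 2) (hi : Im u ^ 2 <= Re u ^ 2) :
  - PI <= 2 * Im (frak_B_inv u) <= PI.
Proof.
  destruct u as [a b]. unfold frak_B_inv, Clog. simpl in *.
  replace (2 * _) with
    (2 * atan (b / a) - (atan (- (b / (sqrt 2 - a))) + atan (b / (sqrt 2 + a)))).
  2:{ replace (- (b / (sqrt 2 - a)))
        with ((0 + (-1 * b + 0 * a)) / (sqrt 2 + (-1 * a - 0 * b))) by (field; lra).
      replace (b / (sqrt 2 + a))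
        with ((0 + (1 * b + 0 * a)) / (sqrt 2 + (1 * a - 0 * b))) by (field; lra).
      field. }
  rewrite atan_opp.
  assert (hv : 0 < / (sqrt 2 - a)) by (apply Rinv_0_lt_compat; lra).
  assert (hw : 0 < / (sqrt 2 + a)) by (apply Rinv_0_lt_compat; lra).
  assert (hz : 0 < / a) by (apply Rinv_0_lt_compat; lra).
  pose proof (atan_bound (b / (sqrt 2 - a))). pose proof (atan_bound (b / (sqrt 2 + a))).
  assert (hm : forall x y, x <= y -> atan x <= atan y).
  { intros x y [h | <-]; [left; apply atan_increasing; exact h | lra]. }
  assert (hba : - 1 <= b / a <= 1).
  { unfold Rdiv. assert (a * / a = 1) by (field; lra). split; nra. }
  assert (h1 : - (PI / 4) <= atan (b / a)) by (rewrite <- atan_1, <- atan_opp; apply hm; lra).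
  assert (h2 : atan (b / a) <= PI / 4) by (rewrite <- atan_1; apply hm; lra).
  destruct (Rle_dec 0 b) as [hb | hb].
  - pose proof (hm 0 (b / (sqrt 2 - a)) ltac:(unfold Rdiv; nra)).
    pose proof (hm 0 (b / (sqrt 2 + a)) ltac:(unfold Rdiv; nra)).
    rewrite atan_0 in *. lra.
  - pose proof (hm (b / (sqrt 2 - a)) 0 ltac:(unfold Rdiv; nra)).
    pose proof (hm (b / (sqrt 2 + a)) 0 ltac:(unfold Rdiv; nra)).
    rewrite atan_0 in *. lra.
Qed.

(** * The disk with diameter [m, e m] *)

Lemma Cmod_Cexp (z : C) : Cmod (Cexp z) = exp (Re z).
Proof.
  pose proof (Cmod2_alt (Cexp z)) as H. unfold Cexp in H at 2 3. simpl in H.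
  pose proof (sin2_cos2 (Im z)) as Hsc. unfold Rsqr in Hsc.
  pose proof (exp_pos (Re z)). pose proof (Cmod_ge_0 (Cexp z)).
  apply Rsqr_inj; unfold Rsqr; nra.
Qed.

(** From exp (2 zeta) = u^2 / (2 - u^2), with r = |u|^2 and N = |2 - u^2|, the data for
    [log_disk_bound] are P = r/N and T = 2/N; cos Y comes from the real part of u^2 times the
    conjugate of 2 - u^2. *)
Lemma disk_frak_B_inv (u : C) (m : R) (hm : 0 < m) (hm2 : m ^ 2 * (1 + exp 1 ^ 2) = 2)
  (hu : (Re u - m) * (Re u - exp 1 * m) + Im u ^ 2 < 0) :
  0 < Re u < sqrt 2 /\ disk (frak_B_inv u).
Proof.
  pose proof exp_1_bounds as He.
  pose proof sqrt_2_sq as Hq. pose proof (sqrt_pos 2) as Hq0.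
  set (e := exp 1) in *.
  assert (hmem : m < e * m) by nra.
  pose proof (pow2_ge_0 (Im u)).
  assert (hlo : m < Re u) by (apply Rnot_le_lt; intros h; nra).
  assert (hhi : Re u < e * m) by (apply Rnot_le_lt; intros h; nra).
  assert (hem : e * m < sqrt 2).
  { apply Rnot_le_lt. intros h. pose proof (pow_lt m 2 hm). nra. }
  assert (hRe : 0 < Re u < sqrt 2) by lra.
  split; [exact hRe |].
  (* The disk lies in the sector |arg u| <= PI/4: completing the square leaves 6e - 1 - e^2,
     positive for 2 < e <= 3. *)
  assert (hIm : Im u ^ 2 <= Re u ^ 2).
  { assert (0 < (4 * Re u - (1 + e) * m) ^ 2 + (6 * e - 1 - e ^ 2) * m ^ 2).
    { apply Rplus_le_lt_0_compat; [apply pow2_ge_0 |].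
      apply Rmult_lt_0_compat; [nra | apply pow_lt; exact hm]. }
    apply Rmult_le_reg_l with 8; [lra |].
    replace ((4 * Re u - (1 + e) * m) ^ 2 + (6 * e - 1 - e ^ 2) * m ^ 2)
      with (8 * Re u ^ 2 - 8 * ((Re u - m) * (e * m - Re u))) in H by ring.
    lra. }
  pose proof (Im_frak_B_inv_bound u hRe hIm) as HY.
  pose proof (Cexp_double_frak_B_inv u hRe) as E.
  pose proof (Re_lt_sqrt_2_neq u hRe) as hn.
  set (z := frak_B_inv u) in *. clearbody z.
  set (N := Cmod (2 - u * u)).
  assert (hN : 0 < N) by (apply Cmod_gt_0; exact hn).
  set (r := Cmod u ^ 2).
  assert (hr : r = Re u ^ 2 + Im u ^ 2) by apply Cmod2_alt.
  set (s := e / (1 + e ^ 2)).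
  assert (hs : 2 * s = e * m ^ 2).
  { unfold s. rewrite <- hm2 at 1. field. nra. }
  assert (EP : exp (2 * Re z) * N = r).
  { pose proof (f_equal Cmod E) as E'. rewrite !Cmod_mult, Cmod_Cexp in E'.
    fold N in E'. unfold r. simpl. rewrite Rmult_1_r, <- E'. do 2 f_equal.
    destruct z; simpl; ring. }
  assert (EN : N ^ 2 = (2 + r) ^ 2 - 8 * Re u ^ 2).
  { unfold N. rewrite Cmod2_alt, hr. destruct u; simpl; ring. }
  assert (EC : exp (2 * Re z) * cos (2 * Im z) * N ^ 2 = 4 * Re u ^ 2 - 2 * r - r ^ 2).
  { assert (E' : (Cexp (z + z) * RtoC (N ^ 2))%C = (u * u * Cconj (2 - u * u))%C).
    { unfold N. rewrite Cmod2_conj, Cmult_assoc, E. reflexivity. }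
    apply (f_equal Re) in E'. rewrite hr.
    replace (2 * Re z) with (Re (z + z)%C) by (destruct z; simpl; ring).
    replace (2 * Im z) with (Im (z + z)%C) by (destruct z; simpl; ring).
    destruct u as [a b]. simpl in E' |- *. lra. }
  assert (hT : 2 / N <= exp (2 * Re z) + 1).
  { pose proof (Cmod_triangle (u * u) (2 - u * u)) as Htri.
    replace (u * u + (2 - u * u))%C with (RtoC 2) in Htri by ring.
    rewrite Cmod_R, Rabs_right, Cmod_mult in Htri by lra. fold N in Htri.
    apply Rmult_le_reg_r with N; [exact hN |].
    replace (2 / N * N) with 2 by (field; lra). unfold r in EP. nra. }
  assert (Hlt : (2 * Re z) ^ 2 + (2 * Im z) ^ 2 < 4).
  { apply (log_disk_bound (2 * Re z) (2 * Im z) (2 / N) s eq_refl HY hT).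
    pose proof (exp_pos (2 * Re z)) as hP. set (P := exp (2 * Re z)) in *.
    set (c := cos (2 * Im z)) in *.
    assert (hr0 : 0 < r) by (rewrite <- EP; nra).
    apply Rmult_lt_reg_r with (N * r); [nra |]. rewrite Rmult_0_l.
    assert (HP : P = r / N) by (rewrite <- EP; field; lra).
    assert (Hc : c = (4 * Re u ^ 2 - 2 * r - r ^ 2) / (r * N)).
    { rewrite <- EC, HP. field. lra. }
    (* Here 2s = e m^2 and 2 + 4s = ((1 + e) m)^2 are the product and the squared sum of the
       endpoints. Membership in the disk reads r + 2s < (1 + e) m Re u; squaring it gives the
       required sign. *)
    replace (_ * (N * r)) with (2 * ((r + 2 * s) ^ 2 - (2 + 4 * s) * Re u ^ 2)).
    - assert (hms : (2 + 4 * s) = ((1 + e) * m) ^ 2) by (rewrite <- hm2; nra).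
      assert (hd : r + 2 * s < (1 + e) * m * Re u) by (rewrite hs, hr; nra).
      assert (0 < s) by nra.
      rewrite hms. nra.
    - rewrite Hc, HP.
      transitivity ((1 - 2 * s) * (r ^ 2 - 2 * r) + 2 * s ^ 2 * (r ^ 2 + N ^ 2)
        - (1 + 2 * s - 4 * s ^ 2) * (4 * Re u ^ 2 - 2 * r - r ^ 2)).
      + rewrite EN. ring.
      + field. lra. }
  unfold disk. pose proof (Cmod2_alt z). pose proof (Cmod_ge_0 z). nra.
Qed.

(** * The Janowski map *)

Lemma janowski_denom_neq (A B : R) (hB : -1 < B < 1) (w : C) (hw : disk w) :
  (1 + RtoC B * w)%C <> 0.
Proof.
  intros h. unfold disk in hw.
  assert (E : Cmod (RtoC B * w) = 1).
  { replace (RtoC B * w)%C with (- (1))%C; [apply Cmod_m1 |].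
    replace (RtoC B * w)%C with (1 + RtoC B * w - 1)%C by ring. rewrite h. ring. }
  rewrite Cmod_mult, Cmod_R in E.
  assert (Rabs B < 1) by (apply Rabs_def1; lra).
  pose proof (Rabs_pos B). pose proof (Cmod_ge_0 w). nra.
Qed.

(** Solving for w gives u - 1 = (A - B u) w, hence |u - 1| < |A - B u|, where A - B u = (A - B)/(1 +
    B w) is nonzero. Squaring and dividing by 1 - B^2 yields the disk. *)
Lemma janowski_in_disk (A B : R) (hB : -1 < B < 1) (hBA : B < A) (w : C) (hw : disk w) :
  let u := janowski A B w in
  (Re u - (1 - A) / (1 - B)) * (Re u - (1 + A) / (1 + B)) + Im u ^ 2 < 0.
Proof.
  intros u. pose proof (janowski_denom_neq A B hB w hw) as hd.
  assert (E : ((u - 1) * 1)%C = ((RtoC A - RtoC B * u) * w)%C).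
  { unfold u, janowski. field. exact hd. }
  assert (hne : 0 < Cmod (RtoC A - RtoC B * u)).
  { apply Cmod_gt_0. intros h.
    assert (E2 : ((RtoC A - RtoC B * u) * (1 + RtoC B * w))%C = RtoC (A - B)).
    { unfold u, janowski. rewrite RtoC_minus. field. exact hd. }
    rewrite h, Cmult_0_l in E2. injection E2. lra. }
  apply (f_equal Cmod) in E. rewrite Cmult_1_r, Cmod_mult in E.
  unfold disk in hw. pose proof (Cmod_ge_0 w). pose proof (Cmod_ge_0 (u - 1)).
  assert (hlt : Cmod (u - 1) ^ 2 < Cmod (RtoC A - RtoC B * u) ^ 2).
  { assert (Cmod (u - 1) < Cmod (RtoC A - RtoC B * u)) by (rewrite E; nra). nra. }
  rewrite !Cmod2_alt in hlt. clearbody u. destruct u as [a b]. simpl in *.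
  apply Rmult_lt_reg_r with ((1 - B) * (1 + B)); [nra |].
  replace (_ * ((1 - B) * (1 + B)))
    with ((a * (1 - B) - (1 - A)) * (a * (1 + B) - (1 + A)) + b ^ 2 * ((1 - B) * (1 + B)))
    by (field; lra).
  lra.
Qed.

Lemma ex_C_derive_mult (f g : C -> C) (z : C)
  (Hf : @ex_derive C_AbsRing C_NormedModule f z)
  (Hg : @ex_derive C_AbsRing C_NormedModule g z) :
  @ex_derive C_AbsRing C_NormedModule (fun x => f x * g x)%C z.
Proof.
  apply ex_C_derive_AbsRing in Hf. apply ex_C_derive_AbsRing in Hg.
  destruct Hf as [lf Hf], Hg as [lg Hg].
  pose proof (filterdiff_mult_fct (K := C_AbsRing) (U := AbsRing_NormedModule C_AbsRing)
                f g z _ _ Cmult_comm Hf Hg) as [_ H].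
  exists (lf * g z + f z * lg)%C. split.
  - apply (is_linear_scal_l (K := C_AbsRing) (V := C_NormedModule)).
  - intros x Hx eps. specialize (H x Hx eps). revert H. apply filter_imp.
    intros y H. change (Cmod (f y * g y - f x * g x - (y - x) * (lf * g z + f z * lg))%C
                        <= eps * Cmod (y - x)%C).
    change (Cmod (f y * g y - f x * g x - ((y - x) * lf * g z + f z * ((y - x) * lg)))%C
            <= eps * Cmod (y - x)%C) in H.
    replace (f y * g y - f x * g x - (y - x) * (lf * g z + f z * lg))%C
      with (f y * g y - f x * g x - ((y - x) * lf * g z + f z * ((y - x) * lg)))%C;
      [exact H |].
    generalize (f y) (g y) (f x) (g x) (f z) (g z). intros. unfold Cminus.
    rewrite Cmult_plus_distr_l. f_equal. f_equal. rewrite !Cmult_assoc.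
    f_equal. f_equal. apply Cmult_comm.
Qed.

Lemma ex_C_derive_janowski (A B : R) (hB : -1 < B < 1) (w : C) (hw : disk w) :
  @ex_derive C_AbsRing C_NormedModule (janowski A B) w.
Proof.
  pose proof (janowski_denom_neq A B hB w hw) as hd.
  apply (ex_C_derive_mult (fun v => 1 + RtoC A * v)%C (fun v => / (1 + RtoC B * v))%C).
  - apply ex_C_derive_affine.
  - apply (ex_C_derive_comp Cinv (fun v => 1 + RtoC B * v)%C).
    + eexists. apply is_C_derive_inv. exact hd.
    + apply ex_C_derive_affine.
Qed.

(** * Nesting of the disks and the composed Schwarz function *)

Theorem corollary2p11 (A B : R)
  (hB : -1 < B) (hBA : B < A) (hA : A <= 1)
  (hleft : (1 - A * B) / (1 - B ^ 2)
             <= (1 + exp 1) / sqrt (2 * (1 + exp 1 ^ 2)) ->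
           A <= 1 - sqrt (2 / (1 + exp 1 ^ 2)) * (1 - B))
  (hright : (1 - A * B) / (1 - B ^ 2)
              >= (1 + exp 1) / sqrt (2 * (1 + exp 1 ^ 2)) ->
            A <= exp 1 * sqrt (2 / (1 + exp 1 ^ 2)) * (1 + B) - 1) :
  forall f : C -> C, S_star_janowski A B f -> S_star_frak_B f.
Proof.
  intros f [Hf [w [Hwa [Hwd [Hw0 Hw]]]]]. split; [exact Hf |].
  pose proof exp_1_bounds as He.
  set (m := sqrt (2 / (1 + exp 1 ^ 2))) in *.
  assert (hfrac : 0 < 2 / (1 + exp 1 ^ 2)) by (apply Rdiv_lt_0_compat; nra).
  assert (hm : 0 < m) by (apply sqrt_lt_R0; exact hfrac).
  assert (hm2 : m ^ 2 * (1 + exp 1 ^ 2) = 2).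
  { unfold m. rewrite pow2_sqrt by lra. field. nra. }
  assert (hmid : (1 + exp 1) / sqrt (2 * (1 + exp 1 ^ 2)) = (m + exp 1 * m) / 2).
  { assert (E : sqrt (2 * (1 + exp 1 ^ 2)) = 2 / m).
    { apply sqrt_lem_1; [nra | left; apply Rdiv_lt_0_compat; lra |].
      assert (E : 1 + exp 1 ^ 2 = 2 / m ^ 2).
      { apply Rmult_eq_reg_l with (m ^ 2); [rewrite hm2; field; lra | nra]. }
      rewrite E. field. lra. }
    rewrite E. field. lra. }
  rewrite hmid in hleft, hright.
  assert (hl0 : 0 < 1 - B) by lra. assert (hr0 : 0 < 1 + B) by lra.
  set (l := (1 - A) / (1 - B)) in *. set (r := (1 + A) / (1 + B)) in *.
  assert (hcenter : (1 - A * B) / (1 - B ^ 2) = (l + r) / 2).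
  { unfold l, r. field. repeat split; nra. }
  rewrite hcenter in hleft, hright.
  assert (El : l * (1 - B) = 1 - A) by (unfold l; field; lra).
  assert (Er : r * (1 + B) = 1 + A) by (unfold r; field; lra).
  (* By [hmid] and [hcenter] the two cases compare the centres of [l, r] and [m, e m]. In each case
     the hypothesis bounds the endpoint on the critical side, and the order of the centres then
     bounds the other. *)
  assert (hlr : m <= l /\ r <= exp 1 * m).
  { destruct (Rle_dec ((l + r) / 2) ((m + exp 1 * m) / 2)) as [h | h].
    - specialize (hleft h).
      assert (m <= l) by (apply Rmult_le_reg_r with (1 - B); lra). lra.
    - specialize (hright ltac:(lra)).
      assert (r <= exp 1 * m) by (apply Rmult_le_reg_r with (1 + B); lra). lra. }
  assert (hu : forall v, disk v -> 0 < Re (janowski A B v) < sqrt 2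
                                   /\ disk (frak_B_inv (janowski A B v))).
  { intros v hv. apply disk_frak_B_inv with m; [exact hm | exact hm2 |].
    pose proof (janowski_in_disk A B ltac:(lra) hBA v hv) as H. cbv zeta in H.
    fold l r in H. set (a := Re (janowski A B v)) in *.
    set (b := Im (janowski A B v)) in *.
    assert (hlr' : l < r).
    { apply Rmult_lt_reg_r with ((1 - B) * (1 + B)); [nra |].
      replace (l * ((1 - B) * (1 + B))) with (l * (1 - B) * (1 + B)) by ring.
      replace (r * ((1 - B) * (1 + B))) with (r * (1 + B) * (1 - B)) by ring.
      rewrite El, Er. nra. }
    pose proof (pow2_ge_0 b).
    assert (l < a < r) by (split; nra).
    assert ((a - l) * (r - a) <= (a - m) * (exp 1 * m - a))
      by (apply Rmult_le_compat; lra).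
    lra. }
  exists (fun z => frak_B_inv (janowski A B (w z))). repeat split.
  - intros z hz. apply (ex_C_derive_comp frak_B_inv (fun z => janowski A B (w z))).
    + apply ex_C_derive_frak_B_inv. apply hu, Hwd, hz.
    + apply (ex_C_derive_comp (janowski A B) w); [| apply Hwa, hz].
      apply ex_C_derive_janowski; [lra | apply Hwd, hz].
  - intros z hz. apply hu, Hwd, hz.
  - rewrite Hw0. replace (janowski A B 0) with (RtoC 1); [apply frak_B_inv_1 |].
    unfold janowski. rewrite !Cmult_0_r, Cplus_0_r. field.
  - intros z hz. rewrite frak_B_frak_B_inv by apply hu, Hwd, hz. apply Hw, hz.
Qed.
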